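(* Let $\sigma\subseteq P$ be an ideal set and let $\phi=\phi_\sigma : X\to X$ be the boundary function for $\sigma$, i.e. $\phi_\sigma(y)=\sup\{x\in\operatorname{orb}_y : (x,y)\in\sigma\}$. Then $\phi$ has the following properties: 1. $\phi(y)\preceq y$ for all $y\in X$. 2. Whenever $\phi(y)$ has a gap below, the following hold: (a) $(\phi(y),y)\in P$; (b) $y$ has a gap below; (c) for every $z \in X$, $y\prec z$ implies $\phi(y)\prec\phi(z)$; (d) there is a neighborhood $N$ (a $G$-set) of $(\phi(y),y)$ such that $(s,t)\in N$ implies $s\preceq\phi(t)$. 3. For all $y,z\in X$, if $y\prec z$ then $\phi(y)\preceq\phi(z)$. 4. If $y$ does not have a gap below, then $\phi(y)=\sup\{\phi(t) : t\prec y\}$.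
   Context: Setting. $X$ is a Cantor space. $G\subseteq X\times X$ is the groupoid (spectrum) of a simple AF C*-algebra $B$ relative to a canonical masa $D\cong C(X)$: $G$ is an equivalence relation on $X$, equal to the union of the graphs of the partial homeomorphisms of $X$ induced by the matrix units of a matrix unit system for $B$. $G$ is a principal groupoid with product $(w,x)\circ(x,z)=(w,z)$ and inverse $(w,x)^{-1}=(x,w)$, and is a topological groupoid in the topology generated by declaring these graphs open (each graph is also compact; this topology is in general not the relative product topology). The map $x\mapsto(x,x)$ is a homeomorphism of $X$ onto an open compact subset of $G$, and $X$ is identified with this diagonal. The coordinate projections $\pi_1,\pi_2$ restricted to $G$ are local homeomorphisms. A $G$-set is an open set on which $\pi_1$ and $\pi_2$ are one-to-one; neighborhoods of points of $G$ are always taken to be $G$-sets. Each equivalence class $\operatorname{orb}_y=\{x: (x,y)\in G\}$ is countable and dense in $X$. There is a continuous injective function $b:X\to\mathbb{R}$, and $P=\{(x,y)\in G: b(x)\le b(y)\}$ (the spectrum of a trivially analytic subalgebra $A\subseteq B$); $P$ is open in $G$, $P\circ P\subseteq P$, $P\cap P^{-1}=X$, $P\cup P^{-1}=G$. The total order on $X$ is $x\preceq y\iff b(x)\le b(y)$; its order topology is the original topology of $X$, and it agrees with $P$ on each equivalence class. $X$ has a minimal element $p_{\min}$ and a maximal element $p_{\max}$. Sups and infs are taken in $(X,\preceq)$ (so $\sup\emptyset=p_{\min}$). If $x\prec y$ and the open order interval with endpoints $x,y$ is empty, then $x$ has a gap above, $y$ has a gap below, $x=\operatorname{pred}y$, $y=\operatorname{succ}x$.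 An ideal set is an open subset $\sigma$ of $P$ such that $(w,x),(y,z)\in P$ and $(x,y)\in\sigma$ imply $(w,z)\in\sigma$. *)

(* Defs.v *)
From HB Require Import structures.
From mathcomp Require Import all_boot all_order all_algebra.
From mathcomp Require Import all_classical all_reals all_analysis.

Set Implicit Arguments.
Unset Strict Implicit.
Unset Printing Implicit Defensive.

Import Order.TTheory GRing.Theory Num.Theory.
Import numFieldNormedType.Exports.

Local Open Scope classical_set_scope.
Local Open Scope ring_scope.

Definition is_cantor_space (X : topologicalType) : Prop :=
  exists (f : X -> cantor_space) (g : cantor_space -> X),
    [/\ continuous f, continuous g, cancel f g & cancel g f].

(* A matrix unit system of a unital AF algebra B = closure of \bigcup_n B_n
   with canonical masa D = C(X), seen through the partial homeomorphisms that
   its matrix units induce on X.  B_n is a direct sum of full matrix algebras: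
   [ridx n] indexes its minimal diagonal projections e_ii, [summand] tells which
   matrix algebra a row belongs to, and there is one matrix unit e_ij for each
   pair of rows of the same summand.  [supp i] is the clopen set whose
   indicator function is e_ii, and e_ij induces the partial homeomorphism
   [mu i j] from [supp j] onto [supp i]; the values of [mu i j] outside
   [supp j] are irrelevant. *)
Record matrix_unit_system (X : topologicalType) := MatrixUnitSystem {
  ridx : nat -> finType ;
  summand : forall n, ridx n -> nat ;
  supp : forall n, ridx n -> set X ;
  mu : forall n, ridx n -> ridx n -> X -> X ;
  supp_clopen : forall n (i : ridx n), clopen (supp i) ;
  supp_neq0 : forall n (i : ridx n), supp i !=set0 ;
  (* the e_ii of B_n are pairwise orthogonal with sum 1 *)
  supp_disj : forall n, trivIset [set: ridx n] (@supp n) ;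
  supp_cover : forall n, \bigcup_(i : ridx n) supp i = [set: X] ;
  (* e_ij is a partial isometry, e_ii is a projection, e_ij e_jk = e_ik *)
  mu_supp : forall n (i j : ridx n), summand i = summand j ->
    forall x, supp j x -> supp i (mu i j x) ;
  mu_cts : forall n (i j : ridx n), summand i = summand j ->
    {within supp j, continuous (mu i j)} ;
  mu_id : forall n (i : ridx n) x, supp i x -> mu i i x = x ;
  mu_comp : forall n (i j k : ridx n),
    summand i = summand j -> summand j = summand k ->
    forall x, supp k x -> mu i j (mu j k x) = mu i k x ;
  (* each matrix unit of B_n is a sum of matrix units of B_(n+1) *)
  mu_refine : forall n (i j : ridx n), summand i = summand j ->
    forall x, supp j x ->
    exists i' j' : ridx n.+1,
      [/\ summand i' = summand j', supp j' x, supp j' `<=` supp j &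
          forall z, supp j' z -> mu i' j' z = mu i j z] ;
  (* the diagonal matrix units generate C(X) *)
  supp_base : forall (x : X) (U : set X), open U -> U x ->
    exists n (i : ridx n), supp i x /\ supp i `<=` U }.

Section Spectrum.
Variables (X : topologicalType) (M : matrix_unit_system X).

Definition unit_graph n (i j : ridx M n) : set (X * X) :=
  [set p | supp j p.2 /\ p.1 = mu i j p.2].

Definition unit_graphs : set (set (X * X)) :=
  [set A | exists n (i j : ridx M n),
     summand i = summand j /\ A = unit_graph i j].

Definition spectrum : set (X * X) := \bigcup_(A in unit_graphs) A.

Definition orb (y : X) : set X := [set x | spectrum (x, y)].

(* The spectrum as a space of its own: its topology is generated by the graphs
   of the matrix units and is in general not the relative product topology. *)
Definition spectrum_space : Type := {p : X * X | p \in spectrum}.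

HB.instance Definition _ := Choice.on spectrum_space.
HB.instance Definition _ := @isSubBaseTopological.Build spectrum_space
  (set spectrum_space)
  [set B | exists2 A, unit_graphs A & B = sval @^-1` A] id.

Definition open_in_spectrum (U : set (X * X)) : Prop :=
  U `<=` spectrum /\ open ((fun p : spectrum_space => sval p) @^-1` U).

Definition G_set (N : set (X * X)) : Prop :=
  [/\ open_in_spectrum N, set_inj N fst & set_inj N snd].

(* B is simple exactly when every equivalence class is dense. *)
Definition simple_spectrum : Prop := forall y : X, dense (orb y).

End Spectrum.

Section TriviallyAnalytic.
Variables (R : realType) (X : topologicalType).
Variables (M : matrix_unit_system X) (b : X -> R).

Definition preceq (x y : X) : Prop := b x <= b y.
Definition prec (x y : X) : Prop := b x < b y.

Definition is_sup (A : set X) (s : X) : Prop :=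
  (forall x, A x -> preceq x s) /\
  (forall u, (forall x, A x -> preceq x u) -> preceq s u).

Definition has_gap_below (y : X) : Prop :=
  exists2 x, prec x y & forall z, ~ (prec x z /\ prec z y).

Definition analytic_part : set (X * X) :=
  [set p | spectrum M p /\ preceq p.1 p.2].

(* Open in [spectrum]: as [analytic_part] is itself open there, this is the
   same as relatively open in [analytic_part]. *)
Definition ideal_set (sigma : set (X * X)) : Prop :=
  [/\ sigma `<=` analytic_part, open_in_spectrum M sigma &
      forall w x y z, analytic_part (w, x) -> analytic_part (y, z) ->
        sigma (x, y) -> sigma (w, z)].

(* When X is compact and b is continuous and injective, every subset of X,
   including set0, has exactly one supremum, so the default value y of [xget]
   is not used. *)
Definition boundary (sigma : set (X * X)) (y : X) : X :=
  xget y [set s | is_sup [set x | orb M y x /\ sigma (x, y)] s].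

End TriviallyAnalytic.

(* Main.v *)
Require Import Defs.
From HB Require Import structures.
From mathcomp Require Import all_boot all_order all_algebra.
From mathcomp Require Import all_classical all_reals all_analysis.

Set Implicit Arguments.
Unset Strict Implicit.
Unset Printing Implicit Defensive.

Import Order.TTheory GRing.Theory Num.Theory.
Import numFieldNormedType.Exports.

Local Open Scope classical_set_scope.
Local Open Scope ring_scope.

(** The graphs of the matrix units form a base of the topology of the groupoid,
    not merely a subbase: any two matrix units can be written in a common
    [B_m], and the diagonal projections of [B_m] are orthogonal, so two graphs
    through one point contain the same graph of level [m] around that point
    ([unit_graphsI], [open_in_spectrumP]).  Hence an ideal set containing
    [(x, y)] contains the graph of an injective continuous map [t |-> s] defined
    around [y] and sending [y] to [x] ([ideal_near]).

    All the claims come from moving along such a graph.  Write [phi] for the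
    boundary function.

    If [y < z], density of the orbit of [z] provides [t] in that orbit,
    distinct from [y] and so close to [y] that [t < z].  The corresponding point
    [(s, t)] of the ideal set composes with [(t, z)], so [(s, z)] is in the
    ideal set, with [s] as close to [x] as desired and [s != x]
    ([ideal_near_orb]).  Letting [s] tend to [x] gives [phi y <= phi z].

    If [phi y] has a gap below, with predecessor [u], the supremum is attained:
    [(phi y, y)] is in the ideal set.  Any [s > u] other than [phi y] is then
    greater than [phi y], so that moving from [(phi y, y)] to a nearby point
    [(s, t)] with [t != y] strictly increases the first coordinate.  With [t]
    in the orbit of [z > y] this gives [phi y < s <= phi z].  With [t < y],
    which exists near [y] when [y] has no gap below, it gives
    [phi y < s <= phi t <= phi y], which is absurd; so [y] has a gap below.

    If [y] has no gap below, compactness provides points [t < y] arbitrarily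
    close to [y] unless [y] is the minimum, and moving from [(x, y)] to [(s, t)]
    bounds [x] by any upper bound of the [phi t] ([boundary_is_sup]); if [y] is
    the minimum, then [phi y = y] is the supremum of the empty set. *)

(** * Cantor spaces *)

Lemma is_cantor_space_compact (X : topologicalType) :
  is_cantor_space X -> compact [set: X].
Proof.
move=> [f [g [_ gcts fK _]]].
have -> : [set: X] = g @` [set: cantor_space].
  by apply/seteqP; split=> // x _; exists (f x).
apply: continuous_compact; last exact: cantor_space_compact.
exact: continuous_subspaceT.
Qed.

Lemma is_cantor_space_perfect (X : topologicalType) (x : X) :
  is_cantor_space X -> ~ open [set x].
Proof.
move=> [f [g [_ gcts fK gK]]] ox.
have /perfectTP/(_ (f x)) := cantor_perfect; apply.
have -> : [set f x] = g @^-1` [set x].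
  by apply/seteqP; split=> y /= => [->|<-]; rewrite ?fK ?gK.
by move/continuousP : gcts; apply.
Qed.

(** * The groupoid of a matrix unit system *)

Section Groupoid.
Variables (X : topologicalType) (M : matrix_unit_system X).

Lemma mu_continuous n (i j : ridx M n) (y : X) :
  summand i = summand j -> supp j y -> {for y, continuous (mu i j)}.
Proof.
move=> ij jy; have [oj _] := supp_clopen j.
have := mu_cts ij; rewrite continuous_open_subspace//.
by apply; rewrite inE.
Qed.

Lemma mu_inj n (i j : ridx M n) (x y : X) :
  summand i = summand j -> supp j x -> supp j y ->
  mu i j x = mu i j y -> x = y.
Proof.
move=> ij jx jy e; rewrite -(mu_id jx) -(mu_id jy).
by rewrite -(mu_comp (esym ij) ij jx) -(mu_comp (esym ij) ij jy) e.
Qed.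

Lemma spectrum_refl (x : X) : spectrum M (x, x).
Proof.
have : [set: X] x by [].
rewrite -(supp_cover M 0%N) => -[i _ ix].
by exists (unit_graph i i) => /=; [exists 0%N, i, i|split; rewrite ?mu_id].
Qed.

(** Splitting a matrix unit of [B_n] repeatedly into matrix units of the next
    levels, and keeping each time the one whose graph contains [p]. *)
Lemma unit_graph_descend n m (i j : ridx M n) (p : X * X) :
  (n <= m)%N -> summand i = summand j -> unit_graph i j p ->
  exists i' j' : ridx M m, [/\ summand i' = summand j', unit_graph i' j' p &
    unit_graph i' j' `<=` unit_graph i j].
Proof.
move=> nm ij ijp; elim: m nm => [|m IH].
  by rewrite leqn0 => /eqP n0; subst n; exists i, j; split.
rewrite leq_eqVlt => /predU1P[n0|]; first by subst n; exists i, j; split.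
rewrite ltnS => /IH[i' [j' [ij' [jp ep] sub]]].
have [i2 [j2 [ij2 jp2 sub2 e2]]] := mu_refine ij' jp.
exists i2, j2; split=> //; first by split=> //; rewrite e2.
by move=> q [jq eq]; apply: sub; split; [exact: sub2|rewrite -e2].
Qed.

(** The rows [i] and [j] are determined by the two coordinates of [p], because
    the supports of the diagonal matrix units of one level are disjoint. *)
Lemma unit_graph_uniq n (i j k l : ridx M n) (p : X * X) :
  summand i = summand j -> summand k = summand l ->
  unit_graph i j p -> unit_graph k l p -> i = k /\ j = l.
Proof.
move=> ij kl [jp eij] [lp ekl]; split.
  apply: (@supp_disj X M n i k) => //; exists p.1.
  by split; [rewrite eij|rewrite ekl]; exact: mu_supp.
by apply: (@supp_disj X M n j l) => //; exists p.2.
Qed.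

(** This is what turns the subbase of unit graphs into a base. *)
Lemma unit_graphsI (A B : set (X * X)) (p : X * X) :
  unit_graphs M A -> unit_graphs M B -> A p -> B p ->
  exists C, [/\ unit_graphs M C, C p & C `<=` A `&` B].
Proof.
move=> [n [i [j [ij ->]]]] [m [k [l [kl ->]]]] ijp klp.
have [i' [j' [ij' ijp' sub]]] := unit_graph_descend (leq_maxl n m) ij ijp.
have [k' [l' [kl' klp' sub']]] := unit_graph_descend (leq_maxr n m) kl klp.
have [ik jl] := unit_graph_uniq ij' kl' ijp' klp'; subst k' l'.
exists (unit_graph i' j'); split=> //; first by exists (maxn n m), i', j'.
by move=> q Cq; split; [exact: sub|exact: sub'].
Qed.

(** Unfolds the topology generated by a subbase: around each of its points an
    open set contains a finite intersection of members of the subbase. *)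
Lemma spectrum_subbase (V : set (spectrum_space M)) (q : spectrum_space M) :
  open V -> V q -> exists s : seq (set (spectrum_space M)),
  [/\ forall B, B \in s -> exists2 A, unit_graphs M A & B = sval @^-1` A,
      forall B, B \in s -> B q &
      forall r, (forall B, B \in s -> B r) -> V r].
Proof.
case=> D sD <- [W DW]; case: (sD _ DW) => E sE EW Wq.
exists (finmap.enum_fset E); split.
- by move=> B /sE; rewrite inE.
- have : W q by exact: Wq.
  by rewrite -EW => + B BE; apply.
- by move=> r rE; exists W => //; have : W r by rewrite -EW => B; exact: rE.
Qed.

Lemma open_in_spectrumP (U : set (X * X)) (p : X * X) :
  open_in_spectrum M U -> U p ->
  exists n (i j : ridx M n),
    [/\ summand i = summand j, unit_graph i j p & unit_graph i j `<=` U].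
Proof.
move=> [sU oU] Up; have [A0 gA0 A0p] := sU _ Up.
have pG : p \in spectrum M by rewrite inE; exact: sU.
have [s [gs sp sV]] := @spectrum_subbase _ (exist _ p pG : spectrum_space M) oU Up.
have [C [[n [i [j [ij ->]]]] Cp sC]] : exists C, [/\ unit_graphs M C, C p &
    forall B, B \in s -> forall r : spectrum_space M, C (sval r) -> B r].
  (* The empty intersection is bounded by any graph through p. *)
  elim: s gs sp {sV} => [_ _|B s IH gs sp]; first by exists A0; split.
  have [||C [gC Cp sC]] := IH.
  - by move=> B' B's; apply: gs; rewrite inE B's orbT.
  - by move=> B' B's; apply: sp; rewrite inE B's orbT.
  have [A gA eB] := gs B (mem_head _ _).
  have Ap : A p by have := sp B (mem_head _ _); rewrite eB.
  have [C' [gC' C'p sC']] := unit_graphsI gC gA Cp Ap.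
  exists C'; split=> // B'; rewrite inE => /predU1P[->|B's] r /sC'[Cr Ar].
    by rewrite eB.
  exact: sC Cr.
exists n, i, j; split=> // r Cr.
have rG : r \in spectrum M.
  by rewrite inE; exists (unit_graph i j) => //; exists n, i, j.
by apply: (sV (exist _ r rG)) => B Bs; apply: sC.
Qed.

Lemma unit_graph_G_set n (i j : ridx M n) :
  summand i = summand j -> G_set M (unit_graph i j).
Proof.
move=> ij; have gij : unit_graphs M (unit_graph i j) by exists n, i, j.
split.
- split; first by move=> p ?; exists (unit_graph i j).
  exists [set (fun r : spectrum_space M => sval r) @^-1` unit_graph i j].
    by move=> _ ->; apply: (@finI_from1 _ _ _ id); exists (unit_graph i j).
  by rewrite bigcup_set1.
- move=> [x1 x2] [y1 y2]; rewrite !inE => -[/= jx ex] [/= jy ey] e.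
  by have <- : x2 = y2; [apply: (mu_inj ij jx jy); rewrite -ex -ey|rewrite e].
- move=> [x1 x2] [y1 y2]; rewrite !inE => -[/= jx ex] [/= jy ey] e.
  by rewrite ex ey e.
Qed.

End Groupoid.

(** * The order defined by an injection into the reals *)

Section Order.
Variables (R : realType) (X : topologicalType) (b : X -> R).
Hypotheses (compactX : compact [set: X]) (b_cts : continuous b).

Lemma closed_max (K : set X) :
  closed K -> K !=set0 -> exists2 v, K v & forall z, K z -> b z <= b v.
Proof.
move=> cK K0; have kK : compact K by exact: subclosed_compact compactX _.
have [|v] := compact_EVT_max K0 kK (f := b); first exact: continuous_subspaceT.
by rewrite inE => Kv vmax; exists v => // z Kz; apply: vmax; rewrite inE.
Qed.

Lemma closed_min (K : set X) :
  closed K -> K !=set0 -> exists2 v, K v & forall z, K z -> b v <= b z.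
Proof.
move=> cK K0; have kK : compact K by exact: subclosed_compact compactX _.
have [|v] := compact_EVT_min K0 kK (f := b); first exact: continuous_subspaceT.
by rewrite inE => Kv vmax; exists v => // z Kz; apply: vmax; rewrite inE.
Qed.

(** The closed set of upper bounds is nonempty, as it contains the maximum of
    the space, and its minimum is the supremum; so the empty set is covered as
    well. *)
Lemma exists_is_sup (A : set X) : [set: X] !=set0 -> exists s, is_sup b A s.
Proof.
move=> X0; have [m _ mmax] := closed_max (@closedT X) X0.
have [||s sA smin] := @closed_min (\bigcap_(x in A) b @^-1` [set r | b x <= r]).
- apply: closed_bigI => x _; apply: closed_comp; last exact: closed_ge.
  by move=> z _; exact: b_cts.
- by exists m => x _; exact: mmax.
by exists s; split=> // u uA; exact: smin.
Qed.

(** If a neighborhood [U] of [y] contained no point below [y], the points below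
    [y] would form a nonempty closed set, and its maximum would be the
    predecessor of [y]. *)
Lemma no_gap_near_below (y w : X) (P : set X) : injective b ->
  ~ has_gap_below b y -> prec b w y -> (\forall t \near y, P t) ->
  exists2 t, prec b t y & P t.
Proof.
move=> b_inj ngap wy nP; have : nbhs y P by exact: nP.
rewrite nbhsE => -[U [oU Uy] sUP].
apply: contrapT => noP; apply: ngap.
have PU t : prec b t y -> ~ U t.
  by move=> ty Ut; apply: noP; exists t => //; exact: sUP.
have [||v [/= vy nUv] vmax] := @closed_max (b @^-1` [set r | r <= b y] `&` ~` U).
- apply: closedI; last exact: open_closedC.
  by apply: closed_comp => [z _|]; [exact: b_cts|exact: closed_le].
- by exists w; split; [exact: ltW|exact: PU].
exists v.
  rewrite /prec lt_neqAle vy andbT; apply/eqP => /b_inj vyE.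
  by apply: nUv; rewrite vyE.
move=> z [vz zy]; have : b z <= b v.
  by apply: vmax; split; [exact: ltW|exact: PU].
by rewrite leNgt vz.
Qed.

End Order.

(** * Boundary functions of ideal sets *)

Section Boundary.
Variables (R : realType) (X : topologicalType) (M : matrix_unit_system X).
Variables (b : X -> R) (sigma : set (X * X)).
Hypotheses (cantorX : is_cantor_space X) (simpleM : simple_spectrum M).
Hypotheses (b_cts : continuous b) (b_inj : injective b).
Hypothesis ideal_sigma : ideal_set M b sigma.

Local Notation phi := (boundary M b sigma).

Let compactX : compact [set: X] := is_cantor_space_compact cantorX.

Lemma boundary_supP (y : X) :
  is_sup b [set x | orb M y x /\ sigma (x, y)] (phi y).
Proof.
have [s] := exists_is_sup compactX b_cts
  [set x | orb M y x /\ sigma (x, y)] (ex_intro _ y I).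
exact: xgetI.
Qed.

Lemma boundary_ub (x y : X) : sigma (x, y) -> b x <= b (phi y).
Proof.
have [sP _ _] := ideal_sigma; move=> sxy.
by have [+ _] := boundary_supP y; apply; split=> //; have [] := sP _ sxy.
Qed.

Lemma boundary_least (y u : X) :
  (forall x, sigma (x, y) -> b x <= b u) -> b (phi y) <= b u.
Proof.
by move=> yu; have [_ +] := boundary_supP y; apply=> x [_]; exact: yu.
Qed.

(** The point [s] is the image of [t] under a matrix unit taking [y] to [x];
    the last clause is the injectivity of that matrix unit, and is what makes
    the inequalities strict when [phi y] has a gap below. *)
Lemma ideal_near (x y : X) (c : R) : sigma (x, y) -> c < b x ->
  \forall t \near y,
    exists s, [/\ sigma (s, t), c < b s & t != y -> s != x].
Proof.
have [_ oS _] := ideal_sigma; move=> sxy cx.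
have [n [i [j [ij [/= jy xE] sub]]]] := open_in_spectrumP oS sxy.
have [oj _] := supp_clopen j.
have ctsb : {for y, continuous (b \o mu i j)}.
  by apply: continuous_comp; [exact: mu_continuous|exact: b_cts].
have : \forall t \near y, c < b (mu i j t).
  by apply: (cvgr_gt _ ctsb); rewrite /= -xE.
have : \forall t \near y, supp j t by exact: open_nbhs_nbhs.
apply: filterS2 => t jt ct; exists (mu i j t); split=> //; first exact: sub.
by apply: contraNneq; rewrite xE => /(mu_inj ij jt jy) ->.
Qed.

(** Since [z] and [y] need not be in the same orbit, [(x, y)] cannot be composed
    with [(y, z)]; it is first moved to a nearby [(s, t)] with [t] in the dense
    orbit of [z].  A Cantor space has no isolated point, so [t] can be taken
    different from [y]. *)
Lemma ideal_near_orb (x y z : X) (c : R) :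
  prec b y z -> sigma (x, y) -> c < b x ->
  exists s, [/\ sigma (s, z), c < b s & s != x].
Proof.
move=> yz sxy cx; have [sP _ sI] := ideal_sigma.
have near_lt : \forall t \near y, b t < b z.
  by apply: (cvgr_lt _ (b_cts (x:=y))).
have : nbhs y [set t | b t < b z /\
    exists s, [/\ sigma (s, t), c < b s & t != y -> s != x]].
  by near=> t; split; near: t => //; exact: ideal_near.
rewrite nbhsE => -[U [oU Uy] sU].
have cly : closed [set y].
  have -> : [set y] = b @^-1` [set b y].
    by apply/seteqP; split=> t /= => [->//|/b_inj].
  by apply: closed_comp => [t _|]; [exact: b_cts|exact: closed_eq].
have oUy : open (U `&` ~` [set y]) by apply: openI => //; exact: closed_openC.
have Uy0 : U `&` ~` [set y] !=set0.
  apply: contrapT => /set0P/negP/negPn/eqP U0.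
  apply: (@is_cantor_space_perfect _ y cantorX).
  rewrite (_ : [set y] = U)//; apply/seteqP; split=> [_ ->//|t Ut].
  apply: contrapT => ty.
  by have : (U `&` ~` [set y]) t by []; rewrite U0.
have [t [[Ut /= /eqP ty] tz]] := simpleM z Uy0 oUy.
have [btz [s [sst cs sx]]] := sU _ Ut.
exists s; split=> //; last exact: sx.
apply: (sI s s t z) => //; last by split=> //=; exact: ltW.
by split=> /=; [exact: spectrum_refl|exact: lexx].
Unshelve. all: by end_near. Qed.

Lemma boundary_le (y : X) : b (phi y) <= b y.
Proof.
by have [sP _ _] := ideal_sigma; apply: boundary_least => x /sP[].
Qed.

Lemma boundary_homo (y z : X) : prec b y z -> b (phi y) <= b (phi z).
Proof.
move=> yz; apply: boundary_least => x sxy; rewrite leNgt; apply/negP => zx.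
have [s [sz cs _]] := ideal_near_orb yz sxy zx.
by have := boundary_ub sz; rewrite leNgt cs.
Qed.

(** Otherwise no [(x, y)] in the ideal set has [x] above the predecessor of
    [phi y], which would be a smaller upper bound. *)
Lemma boundary_gap_attained (y : X) :
  has_gap_below b (phi y) -> sigma (phi y, y).
Proof.
move=> [u uphi nogap]; apply: contrapT => nphi.
suff : b (phi y) <= b u by rewrite leNgt uphi.
apply: boundary_least => x sxy; rewrite leNgt; apply/negP => ux.
apply: (nogap x); split=> //; rewrite /prec lt_neqAle boundary_ub// andbT.
by apply: contra_not_neq nphi => /b_inj <-.
Qed.

Lemma gap_above_lt (u p s : X) : (forall z, ~ (prec b u z /\ prec b z p)) ->
  b u < b s -> s != p -> b p < b s.
Proof.
move=> nogap us sp; rewrite lt_neqAle eq_sym (inj_eq b_inj) sp/= leNgt.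
by apply/negP => ?; apply: (nogap s).
Qed.

Lemma boundary_gap_lt (y z : X) :
  has_gap_below b (phi y) -> prec b y z -> b (phi y) < b (phi z).
Proof.
move=> gap yz; have sy := boundary_gap_attained gap.
have [u uphi nogap] := gap.
have [s [sz us sphi]] := ideal_near_orb yz sy uphi.
exact: lt_le_trans (gap_above_lt nogap us sphi) (boundary_ub sz).
Qed.

Lemma boundary_gap_gap (y : X) :
  has_gap_below b (phi y) -> has_gap_below b y.
Proof.
move=> gap; apply: contrapT => ngap; have sy := boundary_gap_attained gap.
have [u uphi nogap] := gap.
have uy : prec b u y by exact: lt_le_trans uphi (boundary_le y).
have [t ty [s [st us sphi]]] := no_gap_near_below
  compactX b_cts b_inj ngap uy (ideal_near sy uphi).
have tny : t != y by apply: contraTneq ty => ->; rewrite /prec ltxx.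
have := lt_le_trans (gap_above_lt nogap us (sphi tny)) (boundary_ub st).
by rewrite ltNge boundary_homo.
Qed.

Lemma boundary_is_sup (y : X) : ~ has_gap_below b y ->
  is_sup b [set phi t | t in [set t | prec b t y]] (phi y).
Proof.
move=> ngap; split; first by move=> _ [t ty <-]; exact: boundary_homo.
move=> u uub; have [[w wy]|nw] := pselect (exists w, prec b w y).
  apply: boundary_least => x sxy; rewrite leNgt; apply/negP => ux.
  have [t ty [s [st us _]]] := no_gap_near_below
    compactX b_cts b_inj ngap wy (ideal_near sxy ux).
  have := le_trans (boundary_ub st) (uub _ (ex_intro2 _ _ t ty erefl)).
  by rewrite leNgt us.
apply: (le_trans (boundary_le y)); rewrite leNgt; apply/negP => uy.
by apply: nw; exists u.
Qed.

End Boundary.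

Theorem proposition1 (R : realType) (X : topologicalType)
    (M : matrix_unit_system X) (b : X -> R) (sigma : set (X * X))
    (cantorX : is_cantor_space X) (simpleM : simple_spectrum M)
    (b_cts : continuous b) (b_inj : injective b)
    (ideal_sigma : ideal_set M b sigma) :
  let phi := boundary M b sigma in
  [/\ (forall y, preceq b (phi y) y),
      (forall y, has_gap_below b (phi y) ->
         [/\ analytic_part M b (phi y, y),
             has_gap_below b y,
             (forall z, prec b y z -> prec b (phi y) (phi z)) &
             exists N : set (X * X),
               [/\ G_set M N, N (phi y, y) &
                   forall s t, N (s, t) -> preceq b s (phi t)]]),
      (forall y z, prec b y z -> preceq b (phi y) (phi z)) &
      (forall y, ~ has_gap_below b y ->
         is_sup b [set phi t | t in [set t | prec b t y]] (phi y))].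
Proof.
have [sP oS _] := ideal_sigma.
split=> [y|y gap|y z|y]; first exact: boundary_le; first 1 last.
- exact: boundary_homo.
- exact: boundary_is_sup.
have sy := boundary_gap_attained cantorX b_cts b_inj ideal_sigma gap.
split; first exact: sP.
- exact: (boundary_gap_gap cantorX simpleM b_cts b_inj ideal_sigma).
- by move=> z; exact: (boundary_gap_lt cantorX simpleM b_cts b_inj ideal_sigma).
have [n [i [j [ij ijy sub]]]] := open_in_spectrumP oS sy.
exists (unit_graph i j); split=> //; first exact: unit_graph_G_set.
by move=> s t /sub; exact: (boundary_ub cantorX b_cts ideal_sigma).
Qed.
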